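(* There is a constant $c>0$ such that for every $m\ge3$ and $n\ge2m$, with $f:\{0,1\}^m\to\mathbb{R}_+$ given by $f(x)=\left(1-\sum_{i=1}^mx_i\right)^2$, we have $\mathrm{rk}_+(M_n^f)\ge\left(\frac{cn}{m^3\log n}\right)^{m/2}$.
   Context: $M_n^f$ is the $\binom nm\times2^n$ matrix indexed by $m$-element subsets $S\subseteq[n]$ and $x\in\{0,1\}^n$ with $M_n^f(S,x)=f(x_S)$, where $x_S$ lists the coordinates of $x$ in $S$ in increasing order. $\mathrm{rk}_+(M)$ is the nonnegative rank: the smallest $r$ such that $M_{ij}=\langle u_i,v_j\rangle$ with $u_i,v_j\in\mathbb{R}_+^r$. *)

(* Defs.v *)
From mathcomp Require Import all_boot all_order all_algebra.
From mathcomp Require Import all_classical all_reals all_analysis.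
Set Implicit Arguments.
Unset Strict Implicit.
Unset Printing Implicit Defensive.
Import Order.TTheory GRing.Theory Num.Theory.
Local Open Scope ring_scope.

Section NonnegativeRank.
Variables (R : realType) (I J : finType).
Implicit Types M : I -> J -> R.

Definition nneg_fact M (r : nat) : Prop :=
  exists u : I -> 'I_r -> R, exists v : J -> 'I_r -> R,
    [/\ forall i k, 0 <= u i k, forall j k, 0 <= v j k
      & forall i j, M i j = \sum_(k < r) u i k * v j k].

(* The default value 0 is used only if M has a negative entry: see
   nneg_fact_ex and nneg_rankP. *)
Definition nneg_rank M : nat :=
  match pselect (exists r, `[< nneg_fact M r >]) with
  | left exM => ex_minn exM
  | right _ => 0%N
  end.

Lemma nneg_fact_ex M : (forall i j, 0 <= M i j) -> nneg_fact M #|I|.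
Proof.
move=> M0; exists (fun i k => (enum_rank i == k)%:R).
exists (fun j k => M (enum_val k) j); split=> [i k|j k|i j] //.
rewrite (bigD1 (enum_rank i)) //= eqxx mul1r enum_rankK big1 ?addr0 // => k.
by rewrite eq_sym => /negbTE ->; rewrite mul0r.
Qed.

Lemma nneg_rankP M : (forall i j, 0 <= M i j) ->
  nneg_fact M (nneg_rank M) /\
  forall r, nneg_fact M r -> (nneg_rank M <= r)%N.
Proof.
move=> M0; rewrite /nneg_rank; case: pselect => [exM|[]]; last first.
  by exists #|I|; apply/asboolP; exact: nneg_fact_ex.
case: ex_minnP => r /asboolP Mr minr; split=> // s Ms.
by apply: minr; apply/asboolP.
Qed.

End NonnegativeRank.

(* enum_val lists the elements of a set of ordinals in increasing order. *)
Definition restrict (n m : nat) (S : {T : {set 'I_n} | #|T| == m})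
    (x : {ffun 'I_n -> bool}) : {ffun 'I_m -> bool} :=
  [ffun i => x (enum_val (cast_ord (esym (eqP (svalP S))) i))].

Definition pattern_mx (R : realType) (n m : nat)
    (f : {ffun 'I_m -> bool} -> R) :
    {T : {set 'I_n} | #|T| == m} -> {ffun 'I_n -> bool} -> R :=
  fun S x => f (restrict S x).
Arguments pattern_mx {R} n {m} f.

(* Main.v *)
Require Import Defs.
From mathcomp Require Import all_boot all_order all_algebra.
From mathcomp Require Import all_classical all_reals all_analysis.
From mathcomp Require Import zify ring lra fintype finset.
Set Implicit Arguments.
Unset Strict Implicit.
Unset Printing Implicit Defensive.
Import Order.TTheory GRing.Theory Num.Theory.
Local Open Scope ring_scope.

(* Split m * b of the n coordinates into m blocks of size b = n %/ m.  Keep the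
   sets S that pick one element from each block, and record x by its trace on
   each block.  In a nonnegative factorization, the support of each rank-one
   term is a rectangle containing no pair with |S :&: x| = 1, whereas each of
   the (b * 2 ^ (b - 1)) ^ m disjoint pairs lies in one of these rectangles.  An
   induction on the blocks, in the style of Kaibel and Weltge, shows that such
   a rectangle contains at most 2 ^ (b * m) disjoint pairs; hence the rank is at
   least (b / 2) ^ m >= (n / (4 * m)) ^ m, more than what is claimed. *)

(** * Counting disjoint pairs in a rectangle free of unique intersections *)

(** This drives the induction on blocks: U holds the possible elements in one block, V the possible
    traces, and each pair (s, x) is charged to its own set W that contains s and avoids x. *)
Lemma cross_disjoint_card (T : finType) (U : {set T}) (V : {set {set T}}) :
  (forall s x, s \in U -> x \in V -> s \notin x) ->
  (#|U| * #|V| <= #|[set W : {set T} | [exists s in U, s \in W] &&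
                       [exists x in V, [disjoint W & x]]]|)%N.
Proof.
move=> UV; rewrite -cardsX.
(* s and x are read off W = f (s, x), as W :&: U = [set s] and x = ~: (W :|: U). *)
pose f (p : T * {set T}) := p.1 |: ~: (p.2 :|: U).
have fU p : p \in setX U V -> f p :&: U = [set p.1].
  case: p => s x /setXP[sU xV]; apply/setP => t; rewrite !inE /=.
  case: (eqVneq t s) => [->|_] /=; first by rewrite sU.
  by case: (t \in U); rewrite ?orbT ?andbF.
have fV p : p \in setX U V -> p.2 = ~: (f p :|: U).
  case: p => s x /setXP[sU xV]; apply/setP => t; rewrite !inE /=.
  case: (boolP (t \in U)) => [tU|tU].
    by rewrite !orbT /=; apply/negbTE/UV.
  rewrite !orbF; case: (eqVneq t s) => [ts|_] /=; last by rewrite negbK.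
  by rewrite ts sU in tU.
rewrite -(@card_in_imset _ _ f); last first.
  move=> p q pUV qUV fpq; rewrite [p]surjective_pairing [q]surjective_pairing.
  congr pair; last by rewrite (fV p) // (fV q) // fpq.
  by apply: set1_inj; rewrite -(fU p) // -(fU q) // fpq.
apply/subset_leq_card/subsetP => W /imsetP[[s x] /setXP[sU xV] ->].
rewrite inE; apply/andP; split; apply/existsP.
  by exists s; rewrite sU /= setU11.
exists x; rewrite xV /=; apply/pred0P => t /=; rewrite !inE /=.
case: (eqVneq t s) => [->|_] /=; first exact/negbTE/UV.
by case: (t \in x); rewrite ?andbF.
Qed.

Lemma sum_tupleS (T : finType) (m : nat) (F : m.+1.-tuple T -> nat) :
  (\sum_t F t = \sum_(t : m.-tuple T) \sum_(s : T) F (cons_tuple s t))%N.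
Proof.
rewrite pair_big /= (reindex (fun p : m.-tuple T * T => cons_tuple p.2 p.1)) //=.
exists (fun t : m.+1.-tuple T => (behead_tuple t, thead t)) => [[t s] _|t _] /=.
  by congr pair; apply: val_inj.
by apply: val_inj => /=; rewrite [in RHS](tuple_eta t).
Qed.

(** This is |S :&: x| when S picks the element [tnth a i] in block i and x has trace [tnth c i]
    there. *)
Definition meets (b m : nat) (a : m.-tuple 'I_b) (c : m.-tuple {set 'I_b}) : nat :=
  \sum_(i < m) (tnth a i \in tnth c i).

Lemma meets_cons (b m : nat) (s : 'I_b) (x : {set 'I_b})
    (a : m.-tuple 'I_b) (c : m.-tuple {set 'I_b}) :
  meets (cons_tuple s a) (cons_tuple x c) = ((s \in x) + meets a c)%N.
Proof.
rewrite /meets big_ord_recl; congr addn.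
by apply: eq_bigr => i _; rewrite !tnthS.
Qed.

(** Blocks are independent: each offers b choices of an element s and [2 ^ b.-1] traces that avoid
    s. *)
Lemma sum_meets0 (b m : nat) :
  (\sum_(a : m.-tuple 'I_b) \sum_(c : m.-tuple {set 'I_b}) (meets a c == 0)
   = (b * 2 ^ b.-1) ^ m)%N.
Proof.
elim: m => [|m IHm].
  under eq_bigr => a _ do under eq_bigr => c _ do rewrite /meets big_ord0 eqxx.
  by rewrite !sum_nat_const !card_tuple expn0.
rewrite sum_tupleS.
under eq_bigr => a _ do under eq_bigr => s _ do rewrite sum_tupleS.
under eq_bigr => a _ do rewrite exchange_big /=.
rewrite expnS mulnC -IHm big_distrl /=; apply: eq_bigr => a _.
rewrite big_distrl /=; apply: eq_bigr => c _.
under eq_bigr => s _ do under eq_bigr => x _ do rewrite meets_cons addn_eq0.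
case: (meets a c == 0%N); last first.
  by rewrite big1 // => s _; rewrite big1 // => x _; rewrite andbF.
rewrite mul1n -[X in (X * _)%N](card_ord b) -sum_nat_const; apply: eq_bigr => s _.
under eq_bigr => x _ do rewrite andbT eqb0.
have -> : b.-1 = #|~: [set s]| by rewrite cardsC1 card_ord.
rewrite -card_powerset -sum1_card [RHS]big_mkcond /=; apply: eq_bigr => x _.
by rewrite inE subsetC sub1set inE; case: (s \in x).
Qed.

Lemma unique_free_rectangle (b m : nat) (A : pred (m.-tuple 'I_b))
    (B : pred (m.-tuple {set 'I_b})) :
  (forall a c, A a -> B c -> meets a c != 1%N) ->
  (\sum_a \sum_c (A a && B c && (meets a c == 0)) <= 2 ^ (b * m))%N.
Proof.
elim: m A B => [|m IHm] A B AB.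
  rewrite muln0 expn0 (@leq_trans (\sum_(a : 0.-tuple 'I_b)
    \sum_(c : 0.-tuple {set 'I_b}) 1)%N) //.
    by apply: leq_sum => a _; apply: leq_sum => c _; case: (_ && _).
  by rewrite !sum_nat_const !card_tuple.
(* Each W gives a rectangle on the remaining m blocks. The first block elements lie in W and the
   traces avoid W, so the first block adds nothing to [meets] and the value 1 stays excluded. *)
pose AW (W : {set 'I_b}) a := [exists s, A (cons_tuple s a) && (s \in W)].
pose BW (W : {set 'I_b}) c := [exists x, B (cons_tuple x c) && [disjoint W & x]].
have ABW W a c : AW W a -> BW W c -> meets a c != 1%N.
  case/existsP => s /andP[As sW] /existsP[x /andP[Bx Wx]].
  have := AB _ _ As Bx; rewrite meets_cons.
  by rewrite (disjointFr Wx sW) add0n.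
have -> : (2 ^ (b * m.+1) = \sum_(W : {set 'I_b}) 2 ^ (b * m))%N.
  rewrite sum_nat_const mulnS expnD; congr muln.
  by rewrite -cardsT -powersetT card_powerset cardsT card_ord.
apply: (@leq_trans (\sum_(W : {set 'I_b}) \sum_a \sum_c
    (AW W a && BW W c && (meets a c == 0)))%N); last first.
  by apply: leq_sum => W _; exact: IHm (ABW W).
rewrite sum_tupleS.
under eq_bigr => a _ do under eq_bigr => s _ do rewrite sum_tupleS.
under eq_bigr => a _ do rewrite exchange_big /=.
(* It suffices to compare, for fixed tails a and c with [meets a c] zero, the number of extensions
   (s, x) with the number of W whose rectangle contains (a, c). *)
rewrite [X in (_ <= X)%N]exchange_big /=; apply: leq_sum => a _.
rewrite [X in (_ <= X)%N]exchange_big /=; apply: leq_sum => c _.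
under eq_bigr => s _ do under eq_bigr => x _ do rewrite meets_cons addn_eq0.
case: (eqVneq (meets a c) 0%N) => [ac0|_]; last first.
  by rewrite big1 // => s _; rewrite big1 // => x _; rewrite !andbF.
under [X in (_ <= X)%N]eq_bigr => W _ do rewrite andbT.
pose U := [set s | A (cons_tuple s a)]; pose V := [set x | B (cons_tuple x c)].
(* The tails contribute 0, so s in x would make the total exactly 1. *)
have UV s x : s \in U -> x \in V -> s \notin x.
  rewrite !inE => As Bx; have := AB _ _ As Bx.
  by rewrite meets_cons ac0 addn0; case: (s \in x).
have -> : (\sum_(W : {set 'I_b}) (AW W a && BW W c) =
    #|[set W : {set 'I_b} | [exists s in U, s \in W] &&
        [exists x in V, [disjoint W & x]]]|)%N.
  rewrite -sum1_card [RHS]big_mkcond /=; apply: eq_bigr => W _; rewrite inE.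
  have -> : AW W a = [exists s in U, s \in W].
    by apply: eq_existsb => s; rewrite inE.
  have -> : BW W c = [exists x in V, [disjoint W & x]].
    by apply: eq_existsb => x; rewrite inE.
  by case: (_ && _).
apply: leq_trans (cross_disjoint_card UV).
rewrite -sum_nat_const [X in (_ <= X)%N]big_mkcond /=; apply: leq_sum => s _.
rewrite -sum1_card [X in (_ <= X)%N](_ : _ =
  \sum_(x : {set 'I_b}) ((s \in U) && (x \in V)))%N; last first.
  rewrite big_mkcond; case: (s \in U) => /=; last by rewrite big1.
  by apply: eq_bigr => x _; case: (x \in V).
apply: leq_sum => x _; rewrite !inE.
by case: (A _) => //; case: (B _) => //; case: (_ == _).
Qed.

(** * Embedding the blocks into the n coordinates *)

Lemma sum_restrict (R : realType) (n m : nat) (S : {T : {set 'I_n} | #|T| == m})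
    (x : {ffun 'I_n -> bool}) :
  \sum_(i < m) (Defs.restrict S x i)%:R = \sum_(k in sval S) (x k)%:R :> R.
Proof.
rewrite [RHS]big_enum_val /=.
pose h := cast_ord (esym (eqP (svalP S))).
rewrite [RHS](reindex h) /=; last first.
  by exists (cast_ord (eqP (svalP S))) => i _; [exact: cast_ordKV | exact: cast_ordK].
by apply: eq_bigr => i _; rewrite ffunE.
Qed.

Section BlockEmbedding.
Variables (n m b : nat).
Variable iota : 'I_m * 'I_b -> 'I_n.
Hypothesis iota_inj : injective iota.

Definition block_set (a : m.-tuple 'I_b) : {set 'I_n} :=
  [set iota (i, tnth a i) | i in 'I_m].

Lemma card_block_set a : #|block_set a| == m.
Proof.
by rewrite card_imset ?card_ord // => i j /iota_inj[].
Qed.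

Definition block_row a : {T : {set 'I_n} | #|T| == m} :=
  exist _ (block_set a) (card_block_set a).

(** Coordinates outside the image of [iota] are set to false; every block set lies inside that
    image. *)
Definition block_point (c : m.-tuple {set 'I_b}) : {ffun 'I_n -> bool} :=
  [ffun k => k \in [set iota p | p in [set p | p.2 \in tnth c p.1]]].

Lemma sum_restrict_block (R : realType) a c :
  \sum_(i < m) (Defs.restrict (block_row a) (block_point c) i)%:R = (meets a c)%:R :> R.
Proof.
rewrite sum_restrict /= big_imset /=; last by move=> i j _ _ /iota_inj[].
rewrite natr_sum; apply: eq_big => [i|i _]; first by rewrite inE.
by rewrite ffunE mem_imset // inE.
Qed.

End BlockEmbedding.

(** * Lower bounds on the nonnegative rank *)

Lemma nneg_fact_block (R : realType) (n m b r : nat) : (m * b <= n)%N -> (0 < b)%N ->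
  nneg_fact (pattern_mx n (fun x : {ffun 'I_m -> bool} =>
        (1 - \sum_(i < m) (x i)%:R) ^+ 2 : R)) r ->
  (b ^ m <= r * 2 ^ m)%N.
Proof.
move=> mbn b0 [u [v [u0 v0 Muv]]].
have le_mb : (#|{: 'I_m * 'I_b}| <= n)%N by rewrite card_prod !card_ord.
pose iota (p : 'I_m * 'I_b) := widen_ord le_mb (enum_rank p).
have iota_inj : injective iota.
  by move=> p q /(congr1 val) /= pq; apply/enum_rank_inj/val_inj.
pose row := block_row iota_inj; pose pt := block_point iota.
have uvE a c : \sum_(k < r) u (row a) k * v (pt c) k = (1 - (meets a c)%:R) ^+ 2.
  by rewrite -Muv /pattern_mx sum_restrict_block.
pose A k a := 0 < u (row a) k; pose B k c := 0 < v (pt c) k.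
(* If [meets a c] is 1 the entry is 0, which a sum of nonnegative terms with positive k-th term
   cannot be. *)
have AB k a c : A k a -> B k c -> meets a c != 1%N.
  move=> Aa Bc; apply/eqP => ac1; have := uvE a c.
  rewrite ac1 subrr expr0n /= => /eqP; rewrite gt_eqF //.
  rewrite (bigD1 k) //= ltr_pwDl ?mulr_gt0 ?sumr_ge0 // => j _.
  by rewrite mulr_ge0.
(* A disjoint pair has entry 1, so some term is nonzero there. *)
have cover a c : ((meets a c == 0) <= \sum_(k < r) (A k a && B k c && (meets a c == 0)))%N.
  case: eqP => [ac0|//]; have := uvE a c; rewrite ac0 subr0 expr1n.
  case: (boolP [exists k, A k a && B k c]) => [/existsP[k ABk] _|/existsPn nAB].
    by rewrite (bigD1 k) //= ABk.
  move=> /eqP; rewrite big1 => [|k _]; first by rewrite eq_sym oner_eq0.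
  have := nAB k; rewrite /A /B !lt_neqAle u0 v0 !andbT -negb_or negbK.
  by case/orP => /eqP <-; rewrite ?mul0r ?mulr0.
have : ((b * 2 ^ b.-1) ^ m <= r * 2 ^ (b * m))%N.
  rewrite -sum_meets0 -[r in X in (_ <= X)%N]card_ord -sum_nat_const.
  apply: (@leq_trans (\sum_(k < r) \sum_a \sum_c
      (A k a && B k c && (meets a c == 0)))%N); last first.
    by apply: leq_sum => k _; exact: unique_free_rectangle (AB k).
  rewrite [X in (_ <= X)%N]exchange_big /=; apply: leq_sum => a _.
  rewrite [X in (_ <= X)%N]exchange_big /=; apply: leq_sum => c _.
  exact: cover.
(* As b is positive, the common factor [(2 ^ b.-1) ^ m] can be cancelled. *)
have -> : (2 ^ (b * m) = (2 * 2 ^ b.-1) ^ m)%N by rewrite -expnS prednK // expnM.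
rewrite !expnMn mulnA leq_pmul2r //.
by rewrite !expn_gt0.
Qed.

Lemma nneg_rank_square_ge (R : realType) (n m : nat) : (0 < m)%N -> (m <= n)%N ->
  (n%:R / (4 * m%:R)) ^+ m <= (nneg_rank (pattern_mx n
    (fun x : {ffun 'I_m -> bool} => (1 - \sum_(i < m) (x i)%:R) ^+ 2 : R)))%:R :> R.
Proof.
move=> m0 mn; set M := pattern_mx _ _; set r := nneg_rank M.
have M0 S x : 0 <= M S x by exact: sqr_ge0.
have [Mr _] := nneg_rankP M0.
have b0 : (0 < n %/ m)%N by rewrite divn_gt0.
have mbn : (m * (n %/ m) <= n)%N by rewrite mulnC leq_trunc_div.
have := nneg_fact_block mbn b0 Mr; set b := (n %/ m)%N in b0 mbn *.
rewrite -(ler_nat R) natrM !natrX -ler_pdivrMr ?exprn_gt0 // -expr_div_n.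
apply: le_trans; rewrite ler_pXn2r ?nnegrE ?divr_ge0 //.
(* Rounding n / m down loses at most a factor 2, since n < (b + 1) m and b >= 1. *)
have nbm : (n <= 2 * b * m)%N by have := ltn_ceil n m0; rewrite -/b; nia.
rewrite ler_pdivrMr ?mulr_gt0 ?ltr0n // mulrA.
have -> : b%:R / 2 * 4 = (2 * b)%:R :> R by rewrite natrM; lra.
by rewrite -natrM ler_nat.
Qed.

Theorem theorem7p4 (R : realType) :
  exists2 c : R, 0 < c &
    forall (m n : nat), (3 <= m)%N -> (2 * m <= n)%N ->
      let f := fun x : {ffun 'I_m -> bool} =>
        (1 - \sum_(i < m) (x i)%:R) ^+ 2 : R in
      (c * n%:R / (m%:R ^+ 3 * ln n%:R)) `^ (m%:R / 2)
        <= (nneg_rank (pattern_mx n f))%:R.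

Proof.
(* With [ln n] bounded below by 1 / 2, this constant reduces the claim to 16 <= n m, and here n m >=
   18. *)
exists (1 / 2) => [|m n m3 mn /=]; first by lra.
have m0 : (0 < m)%N by apply: leq_trans m3.
have nR : (6 : R) <= n%:R by rewrite (ler_nat R 6); lia.
have mR : (3 : R) <= m%:R by rewrite (ler_nat R 3).
(* From ln (1 / n) <= 1 / n - 1 one gets ln n >= 1 - 1 / n. *)
have ln_ge : 1 / 2 <= ln (n%:R : R).
  have nV : n%:R^-1 <= 1 / 2 :> R.
    by rewrite div1r lef_pV2 ?posrE; lra.
  have nV0 : 0 < n%:R^-1 :> R by rewrite invr_gt0; lra.
  have /le_ln1Dx : -1 < n%:R^-1 - 1 :> R by lra.
  by rewrite addrC subrK lnV ?posrE; lra.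
apply: le_trans (nneg_rank_square_ge R m0 _); last by lia.
set z : R := n%:R / (4 * m%:R).
have z0 : 0 <= z by rewrite divr_ge0 ?mulr_ge0.
(* Writing z ^ m as (z ^ 2) ^ (m / 2) equalizes the exponents, so only the bases remain to be
   compared. *)
rewrite -(powR_mulrn m z0) [X in _ <= _ `^ X](_ : _ = 2 * (m%:R / 2)); last by lra.
rewrite (powRrM z) (powR_mulrn 2) //; apply: ge0_ler_powR.
- by rewrite divr_ge0.
- by rewrite nnegrE divr_ge0 ?mulr_ge0 ?exprn_ge0 //; lra.
- by rewrite nnegrE sqr_ge0.
have lnm : 0 < m%:R ^+ 3 * ln n%:R :> R by rewrite mulr_gt0 ?exprn_gt0 //; lra.
rewrite ler_pdivrMr // /z expr_div_n [leRHS]mulrAC ler_pdivlMr; last first.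
  by rewrite exprn_gt0 //; lra.
set N : R := n%:R in nR ln_ge *; set K : R := m%:R in mR *.
apply: (@le_trans _ _ (N ^+ 2 * (K ^+ 3 * (1 / 2)))); last first.
  by rewrite ler_wpM2l ?sqr_ge0 // ler_wpM2l // exprn_ge0 //; lra.
have NK : 16 <= N * K by nra.
have -> : N ^+ 2 * (K ^+ 3 * (1 / 2)) = (N * K) * (1 / 2 * N * K ^+ 2) by ring.
have -> : 1 / 2 * N * (4 * K) ^+ 2 = 16 * (1 / 2 * N * K ^+ 2) by ring.
by rewrite ler_wpM2r // !mulr_ge0 ?sqr_ge0 //; lra.
Qed.
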